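(* Let $0<\varepsilon<\frac{1}{16}$. There is no deterministic comparison-based $\varepsilon$-approximate quantile summary which stores $o\!\left(\frac{1}{\varepsilon}\log(\varepsilon N)\right)$ items on every input stream of length $N$; that is, for every such summary, the maximum over input streams of length $N$ of the number of items it stores is not $o\!\left(\frac{1}{\varepsilon}\log(\varepsilon N)\right)$ as $N\to\infty$.
   Context: Items come from a totally ordered universe $U$ which is unbounded and continuous: every non-empty open interval of $U$ contains arbitrarily many items. A stream is a sequence of items $a_1,\dots,a_N$ arriving one by one. For a stream $\sigma$ of distinct items and an item $a$, $\mathrm{rank}_\sigma(a)$ is one plus the number of items of $\sigma$ strictly smaller than $a$. An $\varepsilon$-approximate quantile summary is a data structure that processes a stream in one pass and then, given any query $\phi\in[0,1]$, returns an item of the stream whose rank $k'$ satisfies $|k'-\phi N|\le \varepsilon N$ (an $\varepsilon$-approximate $\phi$-quantile). A deterministic data structure $\mathcal{D}$ is comparison-based if: (i) it performs no operation on stream items other than comparisons and equality tests; (ii) its memory is split into an item array $I$, storing only items that have already occurred in the stream (kept sorted non-decreasingly, indexed from 1), and a general memory $G$ containing no item identifiers; once an item is removed from $I$ it cannot be added back unless it appears in the stream again; (iii) on arrival of an item $a_i$, its computation is determined solely by the results of comparisons between $a_i$ and $I[j]$ for $j=1,\dots,|I|$, by $|I|$, and by the contents of $G$; (iv) on a quantile query $\phi$, its computation is determined solely by $|I|$ and $G$, and it can only return an item stored in $I$. Space is measured as the number of items stored in $I$. *)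

(* Defs.v *)
From HB Require Import structures.
From mathcomp Require Import all_boot all_order all_algebra.
From mathcomp Require Import all_classical all_reals all_analysis.

Set Implicit Arguments.
Unset Strict Implicit.
Unset Printing Implicit Defensive.

Import Order.TTheory GRing.Theory Num.Theory.
Import numFieldNormedType.Exports.

Local Open Scope classical_set_scope.
Local Open Scope ring_scope.

Definition unbounded_universe (d : Order.disp_t) (U : orderType d) : Prop :=
  [/\ inhabited U,
      forall x : U, exists y : U, (y < x)%O &
      forall x : U, exists y : U, (x < y)%O].

Definition continuous_universe (d : Order.disp_t) (U : orderType d) : Prop :=
  forall a b : U, (exists x : U, (a < x < b)%O) ->
  forall n : nat, exists s : seq U,
    [/\ uniq s, size s = n & all (fun x => (a < x < b)%O) s].

(* Only the item array of a comparison-based data structure depends on the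
   universe, so the structure itself is given by its general memory and by the
   decisions it takes. On an arrival these are functions of the general memory
   and of the vector of the outcomes of the comparisons of the new item with
   the sorted item array I, whose length is |I|: [kept] tells which positions of I
   are kept, [inserted] whether the new item is stored. On a query, [answer] is
   the 0-based position in I of the returned item, as a function of the general
   memory, of |I| and of phi. *)
Record comparison_based (R : realType) := ComparisonBased {
  memory : Type;
  memory0 : memory;
  new_memory : memory -> seq comparison -> memory;
  kept : memory -> seq comparison -> bitseq;
  inserted : memory -> seq comparison -> bool;
  answer : memory -> nat -> R -> nat
}.

Section Execution.
Variables (R : realType) (d : Order.disp_t) (U : orderType d).
Implicit Types (D : comparison_based R) (s : seq U) (a : U).

Definition compare_items (a b : U) : comparison :=
  if (a < b)%O then Lt else if a == b then Eq else Gt.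

Definition step D (st : seq U * memory D) a : seq U * memory D :=
  let c := [seq compare_items a b | b <- st.1] in
  let J := mask (kept st.2 c) st.1 in
  (if inserted st.2 c then sort <=%O (a :: J) else J, new_memory st.2 c).

Definition run D s : seq U * memory D :=
  foldl (@step D) ([::], memory0 D) s.

Definition rank s a : nat := (count (fun b => (b < a)%O) s).+1.

Definition approx_quantile (eps : R) s (phi : R) a : Prop :=
  a \in s /\
  `|(rank s a)%:R - phi * (size s)%:R| <= eps * (size s)%:R.

(* Ranks are meant for streams of distinct items. If eps * N < 1, then no item
   is an eps-approximate 0-quantile, as ranks start at 1: the guarantee is
   required only for N >= 1 / eps, where all approximate quantiles exist. *)
Definition quantile_summary (eps : R) D : Prop :=
  forall s, uniq s -> 1 <= eps * (size s)%:R ->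
  forall phi : R, 0 <= phi <= 1 ->
  let st := run D s in
  exists2 a, onth st.1 (answer st.2 (size st.1) phi) = Some a &
             approx_quantile eps s phi a.

Definition space D s : nat :=
  \max_(n < (size s).+1) size (run D (take n s)).1.

(* Input streams are the streams of distinct items, those to which the
   guarantee applies. The supremum is a maximum: see [max_space_attained]. *)
Definition max_space D (N : nat) : R :=
  sup [set (space D s)%:R | s in [set s | uniq s /\ size s = N]].

Lemma size_run D s : (size (run D s).1 <= size s)%N.
Proof.
elim/last_ind: s => [//|s a IH]; rewrite /run foldl_rcons size_rcons -/(run D s).
rewrite /step /=; set c := map _ _.
have hm : (size (mask (kept (run D s).2 c) (run D s).1) <= size s)%N.
  by apply: leq_trans IH; apply: size_subseq; apply: mask_subseq.
by case: ifP => _; [rewrite size_sort | apply: leqW].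
Qed.

Lemma space_le D s : (space D s <= size s)%N.
Proof.
apply/bigmax_leqP => n _; apply: leq_trans (size_run _ _) _.
by rewrite size_take_min geq_minr.
Qed.

Lemma space_le_max_space D s : uniq s ->
  (space D s)%:R <= max_space D (size s).
Proof.
move=> us; apply: ub_le_sup; last by exists s.
by exists (size s)%:R => _ [t [_ <-] <-]; rewrite ler_nat space_le.
Qed.

Lemma max_space_attained D s : uniq s ->
  exists t, [/\ uniq t, size t = size s & max_space D (size s) = (space D t)%:R].
Proof.
move=> us.
pose P k := `[< exists t, [/\ uniq t, size t = size s & space D t = k] >].
have exP : exists k, P k by exists (space D s); apply/asboolP; exists s.
have ubP k : P k -> (k <= size s)%N.
  by move=> /asboolP[t [_ <- <-]]; exact: space_le.
case: (ex_maxnP exP ubP) => k /asboolP[t [ut st kt]] kmax.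
exists t; split => //; apply/eqP; rewrite eq_le; apply/andP; split.
  apply: ge_sup; first by exists (space D s)%:R, s.
  move=> _ [v [uv sv] <-]; rewrite ler_nat kt; apply: kmax.
  by apply/asboolP; exists v.
by rewrite -st space_le_max_space.
Qed.

End Execution.

(* Main.v *)
(** An adversary builds two streams p and q of length 2^k that the summary
    cannot distinguish: stored items correspond to each other
    and the general memories agree. A cut is a pair (a, b) such that every stored
    pair (x, y) satisfies x <= a iff y < b; its gap is the number of items of q
    below b minus the number of items of p up to a. A query halfway between these
    two numbers shows that the gap is at most 2 eps N.

    The stream is built recursively, the second half being inserted just above a
    in p and just below b in q, where (a, b) is the cut found for the first half.
    Then the gaps of both halves add up. If at some time in the second half no
    item of the first half is stored, there is moreover a cut of gap at least a
    quarter of the length; otherwise the second half has one unit of space less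
    at its disposal. With space s, the ratio y of gap to length thus satisfies
    4 y >= 1 or y (k+1, s) >= (y (k, s) + y (k, s - 1)) / 2, so that
    4 y >= 1 - (3/4)^k 2^s by induction. As 4 y <= 8 eps < 1/2, the space is
    linear in k. *)
Require Import Defs.
From mathcomp Require Import all_boot all_order all_algebra.
From mathcomp Require Import all_classical all_reals all_analysis.
From mathcomp Require Import zify ring lra.

Import Order.TTheory GRing.Theory Num.Theory.
Import numFieldNormedType.Exports.

Local Open Scope classical_set_scope.
Local Open Scope ring_scope.

(** * Density of the relation [far] *)

Section Far.
Set Implicit Arguments.
Unset Strict Implicit.
Variables (d : Order.disp_t) (U : orderType d).
Implicit Types (x y z : U) (s : seq U).

(* The universe may contain adjacent items x < y with nothing in between, so the
   adversary uses [far], which is dense, instead of [<]. *)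
Definition far x y : Prop := exists z, (x < z < y)%O.

Lemma far_lt {x y} : far x y -> (x < y)%O.
Proof. by case=> z /andP[]; apply: lt_trans. Qed.

Lemma far_le_trans {y x z} : far x y -> (y <= z)%O -> far x z.
Proof.
by case=> t /andP[xt ty] yz; exists t; rewrite xt (lt_le_trans ty yz).
Qed.

Lemma le_far_trans {y x z} : (x <= y)%O -> far y z -> far x z.
Proof.
by move=> xy [t /andP[yt tz]]; exists t; rewrite tz (le_lt_trans xy yt).
Qed.

Hypothesis hcont : continuous_universe U.

(** Of three items strictly between [x] and [y], the middle one has an item on either side. *)
Lemma far_dense x y : far x y -> exists2 z, far x z & far z y.
Proof.
move=> xy; have [s [us ss /allP xsy]] := hcont xy 3.
have := sort_lt_sorted s; have := size_sort <=%O s.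
have {xsy} : {in sort <=%O s, forall t, (x < t < y)%O}.
  by move=> t; rewrite mem_sort => /xsy.
rewrite us ss; case: (sort _ s) => [|z1 [|z2 [|z3 []]]] //= h _ /and3P[lt12 lt23 _].
exists z2; [exists z1|exists z3].
- by rewrite lt12 andbT; case/andP: (h z1 (mem_head _ _)).
- by rewrite lt23; have /h/andP[] : z3 \in [:: z1; z2; z3] by rewrite !inE eqxx !orbT.
Qed.

(** Induction on [s]: each item far above [x] pulls [z] down below it, so one [z] close enough to
    [x] serves the whole finite list. *)
Lemma far_above x y s : far x y -> {in s, forall t, (t <= x)%O \/ far x t} ->
  exists z, [/\ far x z, far z y & {in s, forall t, (t <= x)%O \/ far z t}].
Proof.
move=> xy; elim: s => [_|t s IH h].
  by have [z xz zy] := far_dense xy; exists z.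
have [|z [xz zy hz]] := IH; first by move=> u us; apply: h; rewrite inE us orbT.
have [tx|xt] := h t (mem_head _ _).
  by exists z; split=> // u; rewrite inE => /predU1P[->|/hz]; [left|].
have xm : far x (Order.min z t) by rewrite minEle; case: ifP.
have [m xm1 mm] := far_dense xm.
have mz : far m z by apply: far_le_trans mm _; rewrite ge_min lexx.
exists m; split=> //; first exact: far_le_trans mz (ltW (far_lt zy)).
move=> u; rewrite inE => /predU1P[->|/hz[]]; [right|by left|right].
  by apply: far_le_trans mm _; rewrite ge_min lexx orbT.
exact: far_le_trans mz (ltW (far_lt _)).
Qed.

Lemma far_below x y s : far x y -> {in s, forall t, far t y \/ (y <= t)%O} ->
  exists z, [/\ far x z, far z y & {in s, forall t, far t z \/ (y <= t)%O}].
Proof.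
move=> xy; elim: s => [_|t s IH h].
  by have [z xz zy] := far_dense xy; exists z.
have [|z [xz zy hz]] := IH; first by move=> u us; apply: h; rewrite inE us orbT.
have [ty|yt] := h t (mem_head _ _); last first.
  by exists z; split=> // u; rewrite inE => /predU1P[->|/hz]; [right|].
have my : far (Order.max z t) y by rewrite maxEle; case: ifP.
have [m mm my1] := far_dense my.
have zm : far z m by apply: le_far_trans mm; rewrite le_max lexx.
exists m; split=> //; first exact: le_far_trans (ltW (far_lt xz)) zm.
move=> u; rewrite inE => /predU1P[->|/hz[uz|]]; [left|left|by right].
  by apply: le_far_trans mm; rewrite le_max lexx orbT.
exact: le_far_trans (ltW (far_lt uz)) zm.
Qed.

End Far.

(** * Runs on pairs of streams and indistinguishability *)

Section Twin.
Set Implicit Arguments.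
Unset Strict Implicit.
Variables (R : realType) (d : Order.disp_t) (U : orderType d).
Variable D : comparison_based R.
Implicit Types (w : seq (U * U)) (z t L H : U * U).

(* A pair of streams of equal length is a stream of pairs; its run is driven by
   the first components, and [twin] below says that the second components
   cannot be told apart from them. *)
Definition pair_step (st : seq (U * U) * memory D) z :
    seq (U * U) * memory D :=
  let c := [seq compare_items z.1 t.1 | t <- st.1] in
  let J := mask (kept st.2 c) st.1 in
  (if inserted st.2 c then sort (relpre fst <=%O) (z :: J) else J,
   new_memory st.2 c).

Definition pair_run w := foldl pair_step ([::], memory0 D) w.

Definition stored w := (pair_run w).1.

Lemma pair_run_rcons w z : pair_run (rcons w z) = pair_step (pair_run w) z.
Proof. by rewrite /pair_run foldl_rcons. Qed.

Lemma run_rcons (s : seq U) a : run D (rcons s a) = step (run D s) a.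
Proof. by rewrite /run foldl_rcons. Qed.

Lemma run_unzip1 w :
  run D (unzip1 w) = (unzip1 (stored w), (pair_run w).2).
Proof.
elim/last_ind: w => [//|w z IH].
rewrite /unzip1 map_rcons run_rcons [map _ w]/(unzip1 w) IH.
rewrite /stored pair_run_rcons.
rewrite /step /pair_step /= -[map fst]/(@unzip1 U U) -!map_comp /=.
congr pair; case: ifP => _; last by rewrite [RHS]map_mask.
by rewrite -map_mask (sort_map (z :: _)).
Qed.

(** A discarded pair returns to storage only if it arrives again. *)
Lemma stored_cat w w' z :
  z \in stored (w ++ w') -> z \in stored w \/ z \in w'.
Proof.
elim/last_ind: w' => [|w' t IH]; first by rewrite cats0; left.
rewrite -rcons_cat /stored pair_run_rcons /pair_step /= => h.
have {h} : z = t \/ z \in stored (w ++ w').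
  move: h; case: ifP => _; last by move/mem_mask; right.
  by rewrite mem_sort inE => /predU1P[]; [left|move/mem_mask; right].
case=> [->|/IH[]]; [right|by left|right].
  by rewrite mem_rcons mem_head.
by rewrite mem_rcons inE; apply/orP; right.
Qed.

Lemma mem_stored w z : z \in stored w -> z \in w.
Proof. by move=> h; case: (@stored_cat [::] w z h). Qed.

Definition twin w :=
  run D (unzip2 w) = (unzip2 (stored w), (pair_run w).2) /\
  {in stored w &, forall z t, (z.1 <= t.1)%O = (z.2 <= t.2)%O}.

(** The new pair occupies the same position among the stored items of both streams, so both runs see
    the same comparison outcomes and take the same decisions. *)
Lemma twin_rcons w z : twin w ->
  {in stored w, forall t, (z.1 < t.1)%O /\ (z.2 < t.2)%O \/
                          (t.1 < z.1)%O /\ (t.2 < z.2)%O} ->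
  twin (rcons w z).
Proof.
move=> [rw mono] hz.
have mono_z : {in z :: stored w &, forall u t, (u.1 <= t.1)%O = (u.2 <= t.2)%O}.
  move=> u t; rewrite !inE => /predU1P[->|us] /predU1P[->|ts].
  - by rewrite !lexx.
  - by case: (hz t ts) => -[h1 h2]; rewrite ?(ltW h1) ?(ltW h2) // !leNgt h1 h2.
  - by case: (hz u us) => -[h1 h2]; rewrite ?(ltW h1) ?(ltW h2) // !leNgt h1 h2.
  - exact: mono.
have sub : {subset stored (rcons w z) <= z :: stored w}.
  move=> u; rewrite -cats1 => /stored_cat[us|]; rewrite !inE ?us ?orbT //.
  by move=> ->.
split; last by move=> u t /sub us /sub ts; apply: mono_z.
rewrite /unzip2 map_rcons run_rcons [map _ w]/(unzip2 w) rw.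
rewrite /stored pair_run_rcons /step /pair_step /= -/(stored w).
rewrite -[map snd]/(@unzip2 U U) -!map_comp.
have -> : [seq (compare_items z.2 \o snd) i | i <- stored w] =
          [seq compare_items z.1 t.1 | t <- stored w].
  apply/eq_in_map => t /hz /=; rewrite /compare_items => -[] [h1 h2].
    by rewrite h1 h2.
  by rewrite (lt_gtF h1) (lt_gtF h2) (gt_eqF h1) (gt_eqF h2).
congr pair; case: ifP => _; last by rewrite [RHS]map_mask.
rewrite -map_mask.
(* Both components order the pairs involved alike, so projecting by [snd] commutes with sorting. *)
apply: (@homo_sort_map_in _ _ (mem (z :: stored w)) snd (relpre fst <=%O) <=%O
  _ _ _ _ (z :: _)).
- move=> [u1 u2] [t1 t2] us ts /= h; have := h.
  rewrite -(mono_z _ _ us ts) -(mono_z _ _ ts us) /= => /le_anti ->.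
  by rewrite (le_anti h).
- by move=> t u v _ _ _ /=; apply: le_trans.
- by move=> u t _ _ /=; apply: le_total.
- by move=> u t us ts /=; rewrite (mono_z _ _ us ts).
- apply/allP => u us; rewrite -[X in is_true X]/(u \in z :: stored w) inE.
  by move: us; rewrite inE => /predU1P[->|/mem_mask ->]; rewrite ?eqxx ?orbT.
Qed.

End Twin.

(** * Inequalities for the potential *)

(* The two inequalities preserve 4 (h - l) / 2^k >= 1 - (3/4)^k 2^s, where h - l
   is the gap of a node of size 2^k and s its space; it is multiplied by 4^k and
   stated without subtraction. *)
Lemma potential_double (k s1 s2 s l1 h1 l2 h2 : nat) :
  (s1 <= s)%N -> (s2 < s)%N ->
  (4 ^ k + 4 * 2 ^ k * l1 <= 4 * 2 ^ k * h1 + 3 ^ k * 2 ^ s1)%N ->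
  (4 ^ k + 4 * 2 ^ k * l2 <= 4 * 2 ^ k * h2 + 3 ^ k * 2 ^ s2)%N ->
  (4 ^ k.+1 + 4 * 2 ^ k.+1 * (l1 + l2) <=
   4 * 2 ^ k.+1 * (h1 + h2) + 3 ^ k.+1 * 2 ^ s)%N.
Proof.
move=> s1s s2s e1 e2.
have {}s1s : (2 ^ s1 <= 2 ^ s)%N by rewrite leq_exp2l.
(* The spare unit of space halves the second term; 2 (2^s + 2^(s-1)) = 3 * 2^s gives the new factor
   3. *)
have {}s2s : (2 * 2 ^ s2 <= 2 ^ s)%N by rewrite -expnS leq_exp2l.
have {}s1s : (3 ^ k * 2 ^ s1 <= 3 ^ k * 2 ^ s)%N by rewrite leq_mul2l s1s orbT.
have {}s2s : (3 ^ k * (2 * 2 ^ s2) <= 3 ^ k * 2 ^ s)%N.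
  by rewrite leq_mul2l s2s orbT.
rewrite !expnS; move: e1 e2 s1s s2s.
move: (4 ^ k)%N (2 ^ k)%N (3 ^ k)%N (2 ^ s)%N (2 ^ s1)%N (2 ^ s2)%N.
by move=> X T P Q Q1 Q2; lia.
Qed.

Lemma potential_large_gap (k s l h : nat) : (2 ^ k + 2 * l <= 2 * h)%N ->
  (4 ^ k.+1 + 4 * 2 ^ k.+1 * l <= 4 * 2 ^ k.+1 * h + 3 ^ k.+1 * 2 ^ s)%N.
Proof.
move=> e; have e4 : (4 ^ k = 2 ^ k * 2 ^ k)%N by rewrite -expnMn.
have {}e : (2 ^ k * (2 ^ k + 2 * l) <= 2 ^ k * (2 * h))%N.
  by rewrite leq_mul2l e orbT.
by rewrite !expnS e4; move: (2 ^ k)%N (3 ^ k)%N (2 ^ s)%N e => T P Q; lia.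
Qed.

(** * Recursive construction of the two streams *)

Section Adversary.
Set Implicit Arguments.
Unset Strict Implicit.
Variables (R : realType) (d : Order.disp_t) (U : orderType d).
Variable D : comparison_based R.
Hypothesis hcont : continuous_universe U.
Implicit Types (w : seq (U * U)) (z t L H : U * U) (a b : U).

Local Notation stored := (stored D).

Definition inside L H z :=
  [/\ far L.1 z.1, far z.1 H.1, far L.2 z.2 & far z.2 H.2].

(** First components of [L] and [H] bound an interval for the first stream, second components one
    for the second. New pairs placed inside compare alike with everything stored. *)
Definition free_interval w L H :=
  [/\ far L.1 H.1, far L.2 H.2,
      {in w, forall z, ((z.1 <= L.1)%O \/ (H.1 <= z.1)%O) /\
                       ((z.2 <= L.2)%O \/ (H.2 <= z.2)%O)} &
      {in stored w, forall z, (z.1 <= L.1)%O = (z.2 <= L.2)%O}].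

(* No stored pair separates [a] in the first stream from [b] in the second. *)
Definition cut w L H a b :=
  [/\ (L.1 <= a)%O /\ far a H.1, far L.2 b /\ (b <= H.2)%O,
      {in w, forall z, (z.1 <= a)%O \/ far a z.1},
      {in w, forall z, far z.2 b \/ (b <= z.2)%O} &
      {in stored w, forall z, (z.1 <= a)%O = (z.2 < b)%O}].

Definition lo w a := count (fun z => (z.1 <= a)%O) w.
Definition hi w b := count (fun z => (z.2 < b)%O) w.

Lemma free_interval_stored w L H z : free_interval w L H -> z \in stored w ->
  (z.1 <= L.1)%O /\ (z.2 <= L.2)%O \/ (H.1 <= z.1)%O /\ (H.2 <= z.2)%O.
Proof.
move=> [LH1 LH2 out same] zs; have := same z zs.
have [[h1|h1] [h2|h2]] := out z (mem_stored zs).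
- by left.
- by rewrite h1 leNgt (lt_le_trans (far_lt LH2) h2).
- by rewrite h2 leNgt (lt_le_trans (far_lt LH1) h1).
- by right.
Qed.

(** The new intervals hug the cut, above [a] in the first stream and below [b] in the second; [m]
    and [m'] are chosen so close to it that all earlier items stay clear of them. *)
Lemma cut_free_interval w L H a b : cut w L H a b -> exists m m',
  [/\ far m H.1, far L.2 m' & free_interval w (a, m') (m, b)] /\
  [/\ {in w, forall z, (z.1 <= a)%O \/ far m z.1} &
      {in w, forall z, far z.2 m' \/ (b <= z.2)%O}].
Proof.
move=> [[La aH] [Lb bH] outa outb same].
have [|m [am mH outm]] := @far_above _ _ hcont a H.1 (unzip1 w) aH.
  by move=> _ /mapP[z zw ->]; apply: outa.
have [|m' [Lm mb outm']] := @far_below _ _ hcont L.2 b (unzip2 w) Lb.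
  by move=> _ /mapP[z zw ->]; apply: outb.
have outm1 : {in w, forall z, (z.1 <= a)%O \/ far m z.1}.
  by move=> z zw; apply: outm; apply: map_f.
have outm2 : {in w, forall z, far z.2 m' \/ (b <= z.2)%O}.
  by move=> z zw; apply: outm'; apply: map_f.
exists m, m'; split; split=> //; split=> //= z zw.
- split; first by case: (outm1 z zw) => [|/far_lt/ltW]; [left|right].
  by case: (outm2 z zw) => [/far_lt/ltW|]; [left|right].
- rewrite same //; case: (outm2 z (mem_stored zw)) => [zm|bz].
    by rewrite (ltW (far_lt zm)) (lt_trans (far_lt zm) (far_lt mb)).
  by rewrite ltNge bz leNgt (lt_le_trans (far_lt mb) bz).
Qed.

(** The prefix [u] marks a moment at which [s] pairs of [w] are stored. Only pairs of [w] are
    counted, so that survivors of the first half come on top of the count for the second. *)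
Lemma adversary k w0 L H : twin D w0 -> free_interval w0 L H ->
  exists w a b, exists2 u, prefix u w &
  let s := count (mem w) (stored (w0 ++ u)) in
  [/\ size w = (2 ^ k)%N, {in w, forall z, inside L H z},
      uniq (unzip1 w) /\ uniq (unzip2 w), twin D (w0 ++ w) &
  [/\ cut (w0 ++ w) L H a b, (lo w a <= hi w b)%N &
      (4 ^ k + 4 * 2 ^ k * lo w a <= 4 * 2 ^ k * hi w b + 3 ^ k * 2 ^ s)%N]].
Proof.
elim: k w0 L H => [|k IH] w0 L H tw free.
  have [LH1 LH2 out same] := free.
  have [x Lx xH] := far_dense hcont LH1; have [y Ly yH] := far_dense hcont LH2.
  (* Both counts are 1, so the gap is 0, and the bound holds as 1 <= 2^s. *)
  exists [:: (x, y)], x, H.2; exists [::] => //=.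
  have sep : {in stored w0, forall z, (x < z.1)%O /\ (y < z.2)%O \/
                                      (z.1 < x)%O /\ (z.2 < y)%O}.
    move=> z /(free_interval_stored free)[[h1 h2]|[h1 h2]]; [right|left].
      by rewrite (le_lt_trans h1 (far_lt Lx)) (le_lt_trans h2 (far_lt Ly)).
    by rewrite (lt_le_trans (far_lt xH) h1) (lt_le_trans (far_lt yH) h2).
  split=> //; first by move=> z; rewrite inE => /eqP ->.
    by rewrite cats1; apply: twin_rcons.
  split.
  - split=> //; first by rewrite (ltW (far_lt Lx)).
    + move=> z; rewrite mem_cat inE => /orP[zw|/eqP ->]; last by left.
      have [[h1|h1] _] := out z zw; [left|right].
        exact: le_trans h1 (ltW (far_lt Lx)).
      exact: far_le_trans xH h1.
    + move=> z; rewrite mem_cat inE => /orP[zw|/eqP ->]; last by left.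
      have [_ [h1|h1]] := out z zw; [left|by right].
      exact: le_far_trans h1 LH2.
    + move=> z /stored_cat[zs|]; last first.
        by rewrite inE => /eqP -> /=; rewrite lexx (far_lt yH).
      have [[h1 h2]|[h1 h2]] := free_interval_stored free zs.
        by rewrite (le_trans h1 (ltW (far_lt Lx))) (le_lt_trans h2 (far_lt LH2)).
      by rewrite leNgt (lt_le_trans (far_lt xH) h1) ltNge h2.
  - by rewrite /lo /hi /= lexx (far_lt yH).
  - rewrite /lo /hi /= lexx (far_lt yH) addn0 !expn0 !mul1n addnC.
    by rewrite leq_add2l expn_gt0.
have [w1 [a1 [b1 [u1 pu1 [sz1 in1 [uq11 uq12] tw1 [cut1 lohi1 bound1]]]]]] :=
  IH w0 L H tw free.
have [m [m' [[mH Lm free1] [outm outm']]]] := cut_free_interval cut1.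
have [w2 [a2 [b2 [u2 pu2 [sz2 in2 [uq21 uq22] tw2 [cut2 lohi2 bound2]]]]]] :=
  IH (w0 ++ w1) (a1, m') (m, b1) tw1 free1.
have [[La1 a1H] [Lb1 b1H] _ _ _] := cut1.
have [am mb _ _] := free1; rewrite /= in am mb.
have [LH1 LH2 out same] := free.
have outm1 z : z \in w1 -> (z.1 <= a1)%O \/ far m z.1.
  by move=> zw; apply: outm; rewrite mem_cat zw orbT.
have outm1' z : z \in w1 -> far z.2 m' \/ (b1 <= z.2)%O.
  by move=> zw; apply: outm'; rewrite mem_cat zw orbT.
have disj1 z t : z \in w1 -> t \in w2 -> z.1 != t.1.
  move=> zw /in2[/= at1 tm _ _]; have [za|mz] := outm1 z zw.
    by rewrite lt_eqF // (le_lt_trans za (far_lt at1)).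
  by rewrite gt_eqF // (lt_trans (far_lt tm) (far_lt mz)).
have disj2 z t : z \in w1 -> t \in w2 -> z.2 != t.2.
  move=> zw /in2[/= _ _ mt tb]; have [zm|bz] := outm1' z zw.
    by rewrite lt_eqF // (lt_trans (far_lt zm) (far_lt mt)).
  by rewrite gt_eqF // (lt_le_trans (far_lt tb) bz).
have disj z : z \in w1 -> z \in w2 -> False.
  by move=> z1 z2; have := disj1 z z z1 z2; rewrite eqxx.
have szw : size (w1 ++ w2) = (2 ^ k.+1)%N.
  by rewrite size_cat sz1 sz2 expnS mul2n addnn.
have inw : {in w1 ++ w2, forall z, inside L H z}.
  move=> z; rewrite mem_cat => /orP[/in1//|/in2[/= h1 h2 h3 h4]]; split.
  - exact: le_far_trans La1 h1.
  - exact: far_le_trans h2 (ltW (far_lt mH)).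
  - exact: far_le_trans Lm (ltW (far_lt h3)).
  - exact: far_le_trans h4 b1H.
have uqw : uniq (unzip1 (w1 ++ w2)) /\ uniq (unzip2 (w1 ++ w2)).
  rewrite /unzip1 /unzip2 !map_cat !cat_uniq uq11 uq12 uq21 uq22 !andbT.
  split; apply/hasPn => _ /mapP[t tw' ->]; apply/mapP => -[z zw].
    by apply/eqP; rewrite eq_sym disj1.
  by apply/eqP; rewrite eq_sym disj2.
have tww : twin D (w0 ++ w1 ++ w2) by rewrite catA.
(* Is a pair of the first half still stored at the moment [u2] of the second? *)
have [w1_kept|w1_lost] := boolP (has (mem w1) (stored ((w0 ++ w1) ++ u2))).
  have [[a12 a2m] [mb2 b21] outa2 outb2 same2] := cut2.
  rewrite /= in a12 a2m mb2 b21.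
  have loE : lo (w1 ++ w2) a2 = (lo w1 a1 + lo w2 a2)%N.
    rewrite /lo count_cat; congr addn; apply: eq_in_count => z /outm1[h|h].
      by rewrite h (le_trans h a12).
    rewrite !leNgt (lt_trans (far_lt a2m) (far_lt h)).
    by rewrite (lt_trans (far_lt am) (far_lt h)).
  have hiE : hi (w1 ++ w2) b2 = (hi w1 b1 + hi w2 b2)%N.
    rewrite /hi count_cat; congr addn; apply: eq_in_count => z /outm1'[h|h].
      by rewrite (lt_trans (far_lt h) (far_lt mb)) (lt_trans (far_lt h) (far_lt mb2)).
    by rewrite !ltNge h (le_trans b21 h).
  have cutw : cut (w0 ++ w1 ++ w2) L H a2 b2.
    rewrite catA; split=> //; split.
    - exact: le_trans La1 a12.
    - exact: far_le_trans a2m (ltW (far_lt mH)).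
    - exact: le_far_trans (ltW (far_lt Lm)) mb2.
    - exact: le_trans b21 b1H.
  set s1 := count (mem (w1 ++ w2)) (stored (w0 ++ u1)).
  set s2 := count (mem (w1 ++ w2)) (stored (w0 ++ w1 ++ u2)).
  have s1_ge : (count (mem w1) (stored (w0 ++ u1)) <= s1)%N.
    by apply: sub_count => z /= zw; rewrite mem_cat zw.
  have s2_gt : (count (mem w2) (stored ((w0 ++ w1) ++ u2)) < s2)%N.
    rewrite /s2 catA.
    have -> : count (mem (w1 ++ w2)) (stored ((w0 ++ w1) ++ u2)) =
              count (predU (mem w1) (mem w2)) (stored ((w0 ++ w1) ++ u2)).
      by apply: eq_count => z; rewrite /= mem_cat.
    rewrite -[X in (_ < X)%N]addn0.
    have <- : count (predI (mem w1) (mem w2)) (stored ((w0 ++ w1) ++ u2)) = 0%N.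
      apply/eqP; rewrite -leqn0 leqNgt -has_count; apply/hasP => -[z _].
      by move=> /andP[/=]; apply: disj.
    by rewrite count_predUI -[X in (X < _)%N]add0n ltn_add2r -has_count.
  exists (w1 ++ w2), a2, b2.
  (* The moment with the larger count is kept; it dominates both [s1] and [s2]. *)
  have [s12|s21] := leqP s1 s2.
    exists (w1 ++ u2); first by case/prefixP: pu2 => v ->; rewrite catA prefix_prefix.
    split=> //; split=> //; rewrite loE hiE; first exact: leq_add.
    by apply: potential_double bound1 bound2 => //; apply: leq_trans s1_ge s12.
  exists u1; first by case/prefixP: pu1 => v ->; rewrite -catA prefix_prefix.
  split=> //; split=> //; rewrite loE hiE; first exact: leq_add.
  by apply: potential_double bound1 bound2 => //; apply: ltn_trans s2_gt s21.
have stored_w z : z \in stored (w0 ++ w1 ++ w2) -> z \in stored w0 \/ z \in w2.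
  move=> zs; have [|zw] := stored_cat zs; first by left.
  move: zw; rewrite mem_cat => /orP[zw|]; last by right.
  have [v vE] := prefixP pu2.
  move: zs; rewrite vE catA catA => /stored_cat[zs|zv].
    by case/hasP: w1_lost; exists z.
  by right; rewrite mem_cat zv orbT.
exists (w1 ++ w2).
(* With no pair of [w1] stored, both ([m], [H.2]) and ([L.1], [m']) are cuts, of gaps 2^k -
   [lo w1 a1] and [hi w1 b1] >= [lo w1 a1]. One of them is at least half of 2^k. *)
have [A_small|A_large] := leqP (2 * lo w1 a1) (2 ^ k).
  exists m, H.2; exists [::]; first exact: prefix0s.
  have loE : lo (w1 ++ w2) m = (lo w1 a1 + size w2)%N.
    rewrite /lo count_cat; congr addn.
      apply: eq_in_count => z /outm1[h|h].
        by rewrite h (le_trans h (ltW (far_lt am))).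
      by rewrite !leNgt (far_lt h) (lt_trans (far_lt am) (far_lt h)).
    by apply/eqP; rewrite -all_count; apply/allP => z /in2[_ /= /far_lt/ltW].
  have hiE : hi (w1 ++ w2) H.2 = (size w1 + size w2)%N.
    rewrite -size_cat; apply/eqP; rewrite -all_count.
    by apply/allP => z /inw[_ _ _ /far_lt].
  split=> //; split.
  - split=> //.
    + by rewrite (le_trans La1 (ltW (far_lt am))).
    + move=> z; rewrite catA mem_cat => /orP[/outm[h|]|/in2[_ /= h _ _]].
      * by left; rewrite (le_trans h (ltW (far_lt am))).
      * by right.
      * by left; rewrite (ltW (far_lt h)).
    + move=> z; rewrite mem_cat => /orP[/out[_ [h|h]]|/inw[_ _ _ h]].
      * by left; apply: le_far_trans h LH2.
      * by right.
      * by left.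
    + move=> z /stored_w[/(free_interval_stored free)[[h1 h2]|[h1 h2]]|zw].
      * rewrite (le_lt_trans h2 (far_lt LH2)).
        by rewrite (le_trans h1) // (le_trans La1) // ltW // far_lt.
      * by rewrite ltNge h2 leNgt (lt_le_trans (far_lt mH) h1).
      * have [_ /= h _ _] := in2 z zw; rewrite (ltW (far_lt h)).
        by have [|_ _ _ /far_lt ->] := inw z; first by rewrite mem_cat zw orbT.
  - by rewrite loE hiE leq_add2r /lo count_size.
  - by rewrite loE hiE; apply: potential_large_gap; move: A_small; rewrite sz1; clear; lia.
exists L.1, m'; exists [::]; first exact: prefix0s.
have loE : lo (w1 ++ w2) L.1 = 0%N.
  apply/eqP; rewrite -leqn0 leqNgt -has_count; apply/hasPn => z /inw[h _ _ _].
  by rewrite -ltNge (far_lt h).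
have hiE : hi (w1 ++ w2) m' = hi w1 b1.
  rewrite -[RHS]addn0 /hi count_cat; congr addn.
    apply: eq_in_count => z /outm1'[h|h].
      by rewrite (far_lt h) (lt_trans (far_lt h) (far_lt mb)).
    by rewrite !ltNge h (le_trans (ltW (far_lt mb)) h).
  apply/eqP; rewrite -leqn0 leqNgt -has_count; apply/hasPn => z /in2[_ _ /= h _].
  by rewrite -leNgt (ltW (far_lt h)).
split=> //; split.
- split=> //.
  + by rewrite (le_trans (ltW (far_lt mb)) b1H).
  + move=> z; rewrite mem_cat => /orP[/out[[h|h] _]|/inw[h _ _ _]].
    * by left.
    * by right; apply: far_le_trans LH1 h.
    * by right.
  + move=> z; rewrite catA mem_cat => /orP[/outm'[h|h]|/in2[_ _ /= h _]].
    * by left.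
    * by right; rewrite (le_trans (ltW (far_lt mb)) h).
    * by right; rewrite (ltW (far_lt h)).
  + move=> z /stored_w[/(free_interval_stored free)[[h1 h2]|[h1 h2]]|zw].
    * by rewrite h1 (le_lt_trans h2 (far_lt Lm)).
    * rewrite leNgt (lt_le_trans (far_lt LH1) h1) ltNge (le_trans _ h2) //.
      by rewrite (le_trans (ltW (far_lt mb)) b1H).
    * have [_ _ /= h _] := in2 z zw; rewrite ltNge (ltW (far_lt h)) leNgt.
      by have [|/far_lt -> _ _ _] := inw z; first by rewrite mem_cat zw orbT.
- by rewrite loE.
- by rewrite loE hiE; apply: potential_large_gap; move: A_large lohi1; clear; lia.
Qed.

(** * Accuracy bounds the gap *)

(** A query at (l + h) / 2 selects the same stored pair in both runs. Either its first item is at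
    most [a], of rank at most l, or its second is at least [b], of rank above h; one answer is thus
    off by at least (h - l) / 2. *)
Lemma cut_gap eps w L H a b : quantile_summary U eps D ->
  uniq (unzip1 w) -> uniq (unzip2 w) -> 1 <= eps * (size w)%:R ->
  twin D w -> cut w L H a b ->
  (hi w b)%:R - (lo w a)%:R <= 2 * eps * (size w)%:R.
Proof.
move=> hD uq1 uq2 N_large [run2E _] [_ _ _ _ same].
pose N : R := (size w)%:R; pose l : R := (lo w a)%:R; pose h : R := (hi w b)%:R.
have N_gt0 : 0 < N.
  rewrite /N ltr0n lt0n; apply/negP => /eqP w0.
  by move: N_large; rewrite w0 mulr0 ler10.
have l_ge0 : 0 <= l by [].
have h_ge0 : 0 <= h by [].
have lN : l <= N by rewrite ler_nat count_size.
have hN : h <= N by rewrite ler_nat count_size.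
pose phi := (l + h) / (2 * N).
have phiN : phi * N = (l + h) / 2 by rewrite /phi; field; rewrite gt_eqF.
have phi01 : 0 <= phi <= 1.
  rewrite divr_ge0 ?addr_ge0 ?mulr_ge0 ?(ltW N_gt0) //=.
  by rewrite ler_pdivrMr ?mulr_gt0 //; lra.
have sz1 : size (unzip1 w) = size w by rewrite size_map.
have sz2 : size (unzip2 w) = size w by rewrite size_map.
have := hD (unzip1 w) uq1; rewrite sz1 => /(_ N_large phi phi01) /=.
have := hD (unzip2 w) uq2; rewrite sz2 => /(_ N_large phi phi01) /=.
rewrite run2E run_unzip1 /= !size_map => -[y yE [_ y_rank]] [x xE [x_in x_rank]].
move: xE yE y_rank x_rank; rewrite !onth_map /= sz1 sz2 -/N phiN.
case zE: (onth _ _) => [z|//] [xE] [yE]; rewrite -xE -yE in x_in *.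
rewrite !ler_norml => /andP[_ y_rank] /andP[x_rank _].
have zs : z \in stored w.
  by apply/onthP; exists (answer (pair_run D w).2 (size (stored w)) phi).
have [za|az] := boolP (z.1 <= a)%O.
  suff : (rank (unzip1 w) z.1)%:R <= l by rewrite /l /h in l_ge0 *; lra.
  rewrite ler_nat /rank /lo -(count_map fst (fun c => (c <= a)%O)) -/(unzip1 w).
  (* The item itself is counted by [lo] but not as strictly smaller, which absorbs the plus one in
     [rank]. *)
  rewrite !(permP (perm_to_rem x_in)) /= ltxx za add0n add1n ltnS.
  by apply: sub_count => t /= tz; apply: le_trans (ltW tz) za.
suff : h + 1 <= (rank (unzip2 w) z.2)%:R by lra.
rewrite natr1 ler_nat ltnS /hi count_map.
apply: sub_count => t /= tb; apply: lt_le_trans tb _.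
by move: az; rewrite same // -leNgt.
Qed.

(** * Space lower bound and asymptotics *)

Lemma space_lower_bound eps k : unbounded_universe U ->
  quantile_summary U eps D -> eps < 1 / 16 -> 1 <= eps * (2 ^ k)%:R ->
  exists s : seq U, [/\ uniq s, size s = (2 ^ k)%N &
                        (4 ^ k < 3 ^ k * 2 ^ (Defs.space D s).+1)%N].
Proof.
move=> [[x] /(_ x)[y yx] /(_ x)[z xz]] hD eps_small N_large.
have yz : far y z by exists x; rewrite yx.
have tw0 : twin D ([::] : seq (U * U)) by [].
have free0 : free_interval [::] (y, y) (z, z) by [].
have [w [a [b [u pu [szw _ [uq1 uq2] tww [cutw lohi bound]]]]]] :=
  adversary k tw0 free0.
exists (unzip1 w); rewrite uq1 size_map szw; split=> //.
have s_le : (count (mem w) (stored ([::] ++ u)) <= Defs.space D (unzip1 w))%N.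
  apply: leq_trans (count_size _ _) _; have [v vE] := prefixP pu.
  have su : (size u < (size (unzip1 w)).+1)%N.
    by rewrite ltnS size_map vE size_cat leq_addr.
  apply: leq_trans (leq_bigmax (Ordinal su)) => /=.
  have -> : take (size u) (unzip1 w) = unzip1 u.
    by rewrite vE /unzip1 map_cat take_size_cat // size_map.
  by rewrite run_unzip1 size_map.
(* The gap is at most 2 eps 2^k < 2^k / 8, so the potential bound leaves 4^k / 2 < 3^k 2^s. *)
have gap : (8 * hi w b < 8 * lo w a + 2 ^ k)%N.
  rewrite -(ltr_nat R) natrD !natrM.
  have := cut_gap hD uq1 uq2 _ tww cutw; rewrite szw => /(_ N_large).
  have : 0 < (2 ^ k)%:R :> R by rewrite ltr0n expn_gt0.
  by move=> N_gt0; nra.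
have e4 : (4 ^ k = 2 ^ k * 2 ^ k)%N by rewrite -expnMn.
have {}s_le : (3 ^ k * 2 ^ count (mem w) (stored ([::] ++ u)) <=
               3 ^ k * 2 ^ Defs.space D (unzip1 w))%N.
  by rewrite leq_mul2l leq_exp2l // s_le orbT.
have {}gap : (2 ^ k * (8 * hi w b).+1 <= 2 ^ k * (8 * lo w a + 2 ^ k))%N.
  by rewrite leq_mul2l gap orbT.
have : (0 < 2 ^ k)%N by rewrite expn_gt0.
move: bound s_le gap; rewrite expnS e4 /=.
move: (2 ^ k)%N (3 ^ k)%N (2 ^ count _ _)%N (2 ^ Defs.space D _)%N.
move: (lo w a) (hi w b).
by clear=> l h T P Q S; lia.
Qed.

End Adversary.

Theorem theorem1 (R : realType) (d : Order.disp_t) (U : orderType d)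
  (hub : unbounded_universe U) (hcont : continuous_universe U)
  (eps : R) (heps : 0 < eps < 1 / 16)
  (D : comparison_based R) (hD : quantile_summary U eps D) :
  ~ (max_space U D =o_\oo (fun N : nat => eps^-1 * ln (eps * N%:R))).
Proof.
case/andP: heps => eps_gt0 eps_small /eqoP /(_ (eps / 5)).
have eps5 : 0 < eps / 5 by rewrite divr_gt0.
move=> /(_ eps5) [n0 _ small].
have [n1 n1_large] : exists n1 : nat, 1 <= eps * n1%:R.
  exists (Num.bound eps^-1); rewrite -ler_pdivrMl // mulr1.
  by rewrite ltW // archi_boundP // invr_ge0 ltW.
(* The factor 5 serves because 4 * 3^5 = 972 <= 1024 = 4^5: the bound then forces space at least
   2j. *)
pose j := (maxn n0 n1).+1; pose k := (5 * j)%N.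
have jN : (j <= 2 ^ k)%N.
  by apply: leq_trans (ltnW (ltn_expl k (ltnSn 1))); rewrite leq_pmull.
have N_large : 1 <= eps * (2 ^ k)%:R.
  apply: le_trans n1_large _; rewrite ler_pM2l // ler_nat.
  by apply: leq_trans jN; rewrite /j ltnW // ltnS leq_maxr.
have [s [us szs bound]] := space_lower_bound hcont hub hD eps_small N_large.
have space_large : (2 * j <= Defs.space D s)%N.
  rewrite -ltnS -(@ltn_exp2l 2) // -(@ltn_pmul2l (3 ^ k)) ?expn_gt0 //.
  apply: leq_ltn_trans bound.
  by rewrite /k !expnM -expnMn leq_exp2r.
have := space_le_max_space D us; rewrite szs => space_max.
have N0 : (n0 <= 2 ^ k)%N.
  by apply: leq_trans jN; rewrite /j ltnW // ltnS leq_maxl.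
have := small (2 ^ k)%N N0; rewrite /=.
have ln_ge0 : 0 <= ln (eps * (2 ^ k)%:R) by rewrite ln_ge0.
(* As eps < 1 and ln 2 <= 1, the constant eps / 5 allows space at most k / 5 = j, contradicting
   2j. *)
have ln_le : ln (eps * (2 ^ k)%:R) <= (5 * j)%:R.
  apply: le_trans (_ : ln (2 ^+ k) <= _).
    rewrite ler_ln ?posrE ?mulr_gt0 ?ltr0n ?expn_gt0 ?exprn_gt0 // natrX.
    by rewrite ler_piMl ?exprn_ge0 //; lra.
  rewrite lnXn // -(mulr_natl (ln 2)) -/k ler_piMr //.
  by have := @le_ln1Dx R 1; rewrite -[1 + 1]/(2 : R); apply; lra.
rewrite ger0_norm; last exact: le_trans space_max.
rewrite ger0_norm ?mulr_ge0 ?invr_ge0 ?(ltW eps_gt0) //.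
have -> : eps / 5 * (eps^-1 * ln (eps * (2 ^ k)%:R)) = ln (eps * (2 ^ k)%:R) / 5.
  by field; rewrite gt_eqF.
move=> max_small.
have : (2 * j)%:R <= (5 * j)%:R / 5 :> R.
  apply: le_trans (_ : (Defs.space D s)%:R <= _); first by rewrite ler_nat.
  apply: le_trans space_max (le_trans max_small _).
  by rewrite ler_pM2r.
rewrite !natrM [5%:R * _]mulrC mulfK //.
have : 1 <= j%:R :> R by rewrite ler1n.
by lra.
Qed.
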